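(* There exists a sequence of probabilities $\overline{p}=(p_i)_{i\geq 1}$ in $]0,1]$ such that the Markov chain on $\mathbb{N}$ given by the stochastic Fibonacci adding machine associated to $\overline{p}$ is positive recurrent. In particular, if $\overline{p}=(p_i)_{i\geq 1}\subset\,]0,1]$ satisfies $\sum_{i=2}^{+\infty}p_iF_{2(i-1)}<+\infty$, then the Markov chain associated to $\overline{p}$ is positive recurrent.
   Context: $\mathbb{N}=\{0,1,2,\ldots\}$. Fibonacci numbers: $F_0=1$, $F_1=2$, $F_n=F_{n-1}+F_{n-2}$ for $n\geq 2$. Every $N\in\mathbb{N}$ has a unique Fibonacci expansion $N=\sum_{i\geq 0}\varepsilon_i(N)F_i$ with $\varepsilon_i(N)\in\{0,1\}$, finitely many nonzero digits, and no two consecutive digits both equal to $1$. $[x]$ denotes the integer part of $x$. Stochastic Fibonacci adding machine: let $\overline{p}=(p_i)_{i\geq 1}\subset\,]0,1]$. It is the Markov chain on $\mathbb{N}$ whose one-step transition from a state $N$ with digits $\varepsilon_i=\varepsilon_i(N)$ is as follows. Draw independent random variables $(e_i)_{i\geq 0}$ with $e_i=1$ with probability $p_{i+1}$ and $e_i=0$ with probability $1-p_{i+1}$ (drawn afresh at each step). Put $c_{-1}=1$. The new state is $N'=\sum_i\varepsilon'_iF_i$, where: (a) if $\varepsilon_0=0$, then for all $i\geq 0$: $\varepsilon'_{2i}=\left[\frac{\varepsilon_{2i}+e_ic_{i-1}}{e_i\varepsilon_{2i+1}c_{i-1}+1}\right]$, $\varepsilon'_{2i+1}=\left[\frac{\varepsilon_{2i+1}}{e_ic_{i-1}+1}\right]$,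 $c_i=e_ic_{i-1}\varepsilon_{2i+1}$; (b) if $\varepsilon_0=1$, then $\varepsilon'_0=\left[\frac{1}{e_0+1}\right]$, $c_0=e_0$, and for all $i\geq 1$: $\varepsilon'_{2i-1}=\left[\frac{\varepsilon_{2i-1}+e_ic_{i-1}}{e_i\varepsilon_{2i}c_{i-1}+1}\right]$, $\varepsilon'_{2i}=\left[\frac{\varepsilon_{2i}}{e_ic_{i-1}+1}\right]$, $c_i=e_ic_{i-1}\varepsilon_{2i}$. The chain is called positive recurrent if every state is recurrent with finite mean return time. *)

(* Defs.v *)
From HB Require Import structures.
From mathcomp Require Import all_boot all_order all_algebra finmap.
From mathcomp Require Import all_classical all_reals all_analysis.

Set Implicit Arguments.
Unset Strict Implicit.
Unset Printing Implicit Defensive.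

Import Order.TTheory GRing.Theory Num.Theory.

Local Open Scope classical_set_scope.

(** * Fibonacci expansions *)

(* Shifted convention: 1, 2, 3, 5, 8, and so on. *)
Fixpoint fib (n : nat) : nat :=
  match n with
  | 0 => 1
  | m.+1 => match m with 0 => 2 | k.+1 => fib m + fib k end
  end.

(* The sum has finite support wherever it is used (a big operator over a
   classical set is 0 otherwise). *)
Definition fib_value (eps : nat -> nat) : nat :=
  \big[addn/0%N]_(i \in [set: nat]) (eps i * fib i)%N.

Definition is_fib_expansion (N : nat) (eps : nat -> nat) : Prop :=
  [/\ forall i, eps i = 0 \/ eps i = 1,
      finite_set [set i | eps i <> 0],
      forall i, ~ (eps i = 1 /\ eps i.+1 = 1) &
      N = fib_value eps].

(* By Zeckendorf's theorem exactly one sequence satisfies the predicate. *)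
Definition fib_digits (N : nat) : nat -> nat :=
  get [set eps : nat -> nat | is_fib_expansion N eps].

(** * The stochastic Fibonacci adding machine *)

Section transition.
Variables (eps : nat -> nat) (e : nat -> bool).

(* Case eps 0 = 0.  Indices are shifted by one: [carry0 i] is c_(i-1). *)
Fixpoint carry0 (i : nat) : nat :=
  match i with
  | 0 => 1
  | k.+1 => e k * carry0 k * eps k.*2.+1
  end.

Definition next_digits0 (j : nat) : nat :=
  let i := j./2 in
  if odd j then eps i.*2.+1 %/ (e i * carry0 i + 1)
  else (eps i.*2 + e i * carry0 i) %/ (e i * eps i.*2.+1 * carry0 i + 1).

(* Case eps 0 = 1.  No shift here: [carry1 i] is c_i. *)
Fixpoint carry1 (i : nat) : nat :=
  match i with
  | 0 => e 0
  | k.+1 => e k.+1 * carry1 k * eps k.+1.*2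
  end.

(* The successor k.+1 plays the role of i in the indices 2i-1 and 2i. *)
Definition next_digits1 (j : nat) : nat :=
  match j with
  | 0 => 1 %/ (e 0 + 1)
  | h.+1 =>
    let k := h./2 in
    if odd h then eps k.+1.*2 %/ (e k.+1 * carry1 k + 1)
    else (eps k.*2.+1 + e k.+1 * carry1 k)
           %/ (e k.+1 * eps k.+1.*2 * carry1 k + 1)
  end.

Lemma next_digits0_even i : next_digits0 i.*2 =
  (eps i.*2 + e i * carry0 i) %/ (e i * eps i.*2.+1 * carry0 i + 1).
Proof. by rewrite /next_digits0 odd_double doubleK. Qed.

Lemma next_digits0_odd i : next_digits0 i.*2.+1 =
  eps i.*2.+1 %/ (e i * carry0 i + 1).
Proof. by rewrite /next_digits0 /= odd_double /= uphalf_double. Qed.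

Lemma next_digits1_odd i : 0 < i -> next_digits1 i.*2.-1 =
  (eps i.*2.-1 + e i * carry1 i.-1) %/ (e i * eps i.*2 * carry1 i.-1 + 1).
Proof. by case: i => // k _; rewrite /= odd_double doubleK. Qed.

Lemma next_digits1_even i : 0 < i -> next_digits1 i.*2 =
  eps i.*2 %/ (e i * carry1 i.-1 + 1).
Proof. by case: i => // k _; rewrite /= odd_double /= uphalf_double. Qed.

End transition.

Definition fib_step (e : nat -> bool) (N : nat) : nat :=
  let eps := fib_digits N in
  fib_value (if eps 0 == 0 then next_digits0 eps e else next_digits1 eps e).

(* [e t i] is the i-th draw of the step leading from time t to time t + 1. *)
Fixpoint fib_chain (T : Type) (e : nat -> nat -> T -> bool) (N t : nat) (w : T)
    : nat :=
  match t with
  | 0 => N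
  | s.+1 => fib_step (fun i => e s i w) (fib_chain e N s w)
  end.

Local Open Scope ring_scope.

(** * Independence, recurrence *)

Section probability_space.
Context (d : measure_display) (T : measurableType d) (R : realType)
  (P : probability T R).

Definition mutually_independent (d' : measure_display)
    (T' : measurableType d') (I : choiceType) (X : I -> {RV P >-> T'}) : Prop :=
  forall (J : {fset I}) (A : I -> set T'), (forall i, measurable (A i)) ->
  P (\bigcap_(i in [set` J]) (X i @^-1` A i)) =
  (\prod_(i <- J) P (X i @^-1` A i))%E.

(* The infimum of the empty set is +oo. *)
Definition return_time (X : nat -> T -> nat) (N : nat) (w : T) : \bar R :=
  ereal_inf [set n%:R%:E | n in [set n : nat | (0 < n)%N /\ X n w = N]].

(* X N is the chain started at N. *)
Definition positive_recurrent (X : nat -> nat -> T -> nat) : Prop :=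
  forall N,
    P [set w | (return_time (X N) N w < +oo)%E] = 1%E /\
    (\int[P]_w return_time (X N) N w < +oo)%E.

Definition fib_draws (p : nat -> R) (e : nat -> nat -> {RV P >-> bool}) : Prop :=
  (forall t i, P [set w | e t i w] = (p i.+1)%:E) /\
  mutually_independent (fun ti : nat * nat => e ti.1 ti.2).

End probability_space.

(* Entry p 0 is never used. *)
Definition probability_sequence (R : realType) (p : nat -> R) : Prop :=
  forall i, (1 <= i)%N -> 0 < p i <= 1.

(* Positive recurrence only depends on the law of the chain; it is required of
   every realization by independent draws, on any probability space. *)
Definition fib_machine_positive_recurrent (R : realType) (p : nat -> R) : Prop :=
  forall (d : measure_display) (T : measurableType d) (P : probability T R)
    (e : nat -> nat -> {RV P >-> bool}),
  fib_draws p e -> positive_recurrent P (fib_chain e).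

(* Main.v *)
Require Import Defs.
From mathcomp Require Import all_boot all_order all_algebra finmap.
From mathcomp Require Import all_classical all_reals all_analysis.
From mathcomp Require Import measurable_realfun zify ring lra.

Import Order.TTheory GRing.Theory Num.Theory.

Set Implicit Arguments.
Unset Strict Implicit.
Unset Printing Implicit Defensive.

(** Let G_n be the mean time that the chain started at 0 needs to reach F_n.
    A state F_n + M with M < F_(n-1) moves as M does until the carry reaches
    the leading digit; then a single further draw, of success probability q,
    sends the chain to F_(n+1) or down to 0.  With q_n = p_j where
    j = ceil(n/2) + 1, this gives q_(n+2) G_(n+2) = G_(n+1) + G_n.  Consequently
    the weight u(N) = \sum_i eps_i(N) G_i of the digits of N is a clock: its
    mean increases by exactly 1 at each step of the chain ([expect_time]).

    In the other direction, let h_n = p_1 q_1 ... q_n, the probability that the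
    chain started at 0 reaches F_n before returning to 0.  The function equal to
    c / h_n on [F_n, F_(n+1)) and to 0 at 0 does not increase in mean off 0
    ([expect_ladder]): when the carry is about to change the leading position,
    the state is F_(n+1) - 1, and the gain of going to F_(n+1) with probability
    q_(n+1) is balanced by the loss of falling to 0.

    The difference (c / h_n) - u is therefore a function whose mean drops by at
    least 1 per step off 0, and it is nonnegative if h_n G_n <= c for all n.  Now
    A_n = h_n G_n satisfies A_(n+2) = A_(n+1) + q_(n+1) A_n, hence A_n <= F_n,
    and summing the increments bounds A_n by
    2 + \sum_(i >= 2) p_i F_(2(i-1)) ([scaled_time_bounded]): this is where the
    summability hypothesis enters.  Replacing 0 by an arbitrary target N0, the
    function K - u + 1_(N > N0) c / h_n, with K large enough for the finitely
    many states up to N0, still works ([foster_potential]).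

    By Foster's argument such a potential V bounds the mean return time to N0
    by 1 plus the mean of V after one step from N0.  What remains is to read off
    the possible outcomes of one step from the digit rules ([fib_stepE]), and to
    show that the state at time t is independent of the draws made from time t
    on ([prob_avoid_cylinder]). *)

(** * Zeckendorf expansions *)

(** One notion serves for the leading ones of a row of draws, for the carry
    digits of a state, and for the Fibonacci numbers below a state. *)
Definition run (f : nat -> bool) (n : nat) : nat :=
  find (fun i => ~~ f i) (iota 0 n).

Lemma run_le f n : run f n <= n.
Proof. by rewrite /run -[X in _ <= X](size_iota 0 n) find_size. Qed.

Lemma lt_run f n i : i < run f n -> f i.
Proof.
move=> lti; have ltn : i < n by apply: leq_trans lti (run_le f n).
by move: (before_find 0 lti); rewrite nth_iota // => /negbFE.
Qed.

Lemma run_stop f n : run f n < n -> ~~ f (run f n).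
Proof.
move=> ltn; have /(nth_find 0) : has (fun i => ~~ f i) (iota 0 n).
  by rewrite has_find size_iota.
by rewrite nth_iota.
Qed.

(** One inequality says both that the digits are at most 1 and that no two
    consecutive ones occur. *)
Definition zeckendorf (eps : nat -> nat) : Prop :=
  forall i, eps i + eps i.+1 <= 1.

Arguments fib : simpl never.

Lemma fibSS n : fib n.+2 = fib n.+1 + fib n. Proof. by []. Qed.

Lemma fib_gt n : n < fib n.
Proof.
elim/ltn_ind: n => -[|[|n]] // IH; rewrite fibSS.
have := IH n.+1 (ltnSn _); have := IH n (leqnSn _); lia.
Qed.

Lemma fib_homo m n : m <= n -> fib m <= fib n.
Proof.
apply: (homo_leq (@leqnn) leq_trans) => i.
by case: i => [|i] //; rewrite fibSS leq_addr.
Qed.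

Definition fib_sum (n : nat) (eps : nat -> nat) := \sum_(i < n) eps i * fib i.

(** If the top digit of an expansion of length n + 2 is 1, the next one is 0, so
    what is left is an expansion of length n, of value less than F_n. *)
Lemma fib_sum_lt eps n : zeckendorf eps -> fib_sum n eps < fib n.
Proof.
move=> Z; elim/ltn_ind: n => -[|[|n]] IH.
- by rewrite /fib_sum big_ord0.
- by rewrite /fib_sum big_ord_recr big_ord0 /= /fib; have := Z 0; lia.
have := IH n.+1 (ltnSn _); have := IH n (leqnSn _).
rewrite /fib_sum !big_ord_recr /= -/(fib_sum n eps) fibSS => H1 H2.
have := Z n.
case: (eps n.+1) H2 => [|[|m]]; case: (eps n) => [|[|l]] //=; lia.
Qed.

(** The top digits agree because [fib_sum_lt] confines the value of an expansion
    of length n + 1 to [0, F_n) or [F_n, F_(n+1)) according to its top digit. *)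
Lemma fib_sum_inj eps eps' n : zeckendorf eps -> zeckendorf eps' ->
  fib_sum n eps = fib_sum n eps' -> forall i, i < n -> eps i = eps' i.
Proof.
move=> Z Z'; elim: n => // n IH.
have := fib_sum_lt n Z; have := fib_sum_lt n Z'.
rewrite /fib_sum !big_ord_recr /= -/(fib_sum n eps) -/(fib_sum n eps') => L L' E.
have En : eps n = eps' n.
  have := Z n; have := Z' n.
  by case: (eps n) E => [|[|m]]; case: (eps' n) => [|[|m']] //=; lia.
move=> i; rewrite ltnS leq_eqVlt => /predU1P[->//|]; apply: IH.
by move: E; rewrite En => /addIn.
Qed.

(** Greedy expansion.  The induction jumps from n + 2 to n when F_(n+1) is used,
    which leaves digit n equal to 0. *)
Lemma zeckendorf_exists n N : N < fib n -> exists eps,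
  [/\ zeckendorf eps, (forall i, n <= i -> eps i = 0) & fib_sum n eps = N].
Proof.
elim/ltn_ind: n N => -[|[|n]] IH N ltN.
- exists (fun=> 0); split=> //; rewrite /fib_sum big_ord0; move: ltN; rewrite /fib; lia.
- exists (fun i => if i == 0 then N else 0).
  split=> [[|i]|[|i]|] //=; first by move: ltN; rewrite /fib; lia.
  by rewrite /fib_sum big_ord_recr big_ord0 /= /fib muln1.
have [ltN'|geN] := ltnP N (fib n.+1).
  have [eps [Z S E]] := IH n.+1 (ltnSn _) N ltN'.
  exists eps; split=> // [i lei|]; first by apply: S; lia.
  by rewrite /fib_sum big_ord_recr /= S // mul0n addn0.
have ltN' : N - fib n.+1 < fib n by move: ltN; rewrite fibSS; lia.
have [eps [Z S E]] := IH n (leqnSn _) _ ltN'.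
exists (fun i => if i == n.+1 then 1 else eps i); split.
- move=> i; have := Z i; rewrite eqSS.
  case: (eqVneq i n.+1) => [->|_]; first by rewrite eqn_leq ltnn /= (S n.+2) //; lia.
  by case: (eqVneq i n) => [->|_] //; rewrite (S n).
- by move=> i lei; rewrite (_ : (i == n.+1) = false) ?S //; lia.
rewrite /fib_sum !big_ord_recr /= eqxx (_ : (n == n.+1) = false); last by lia.
rewrite (S n) // mul0n addn0 mul1n.
rewrite (eq_bigr (fun i : 'I_n => eps i * fib i)).
  by rewrite -/(fib_sum n eps) E; lia.
by move=> [i lti] _ /=; rewrite (_ : (i == n.+1) = false) //; lia.
Qed.

Lemma fib_valueE n eps : (forall i, n <= i -> eps i = 0) ->
  fib_value eps = fib_sum n eps.
Proof.
move=> S; rewrite /fib_value /fib_sum.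
rewrite (fsbig_ord addn n (fun i => eps i * fib i)).
apply/esym/fsbig_widen => // i [_ /=].
by move=> /negP; rewrite -leqNgt => /S ->; rewrite mul0n.
Qed.

Lemma fib_digitsP N : [/\ zeckendorf (fib_digits N),
  (forall n, N < fib n -> forall i, n <= i -> fib_digits N i = 0) &
  forall n, N < fib n -> fib_sum n (fib_digits N) = N].
Proof.
have [eps [Z S E]] := zeckendorf_exists (fib_gt N).
have : is_fib_expansion N (fib_digits N).
  apply: (@getI _ [set eps | is_fib_expansion N eps] eps); split.
  - by move=> i; have := Z i; lia.
  - apply: (sub_finite_set _ (finite_II N)) => i /= Ni.
    by rewrite ltnNge; apply/negP => /S.
  - by move=> i; have := Z i; lia.
  - by rewrite (fib_valueE S).
case=> d01 fin Z' VE.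
have ZN : zeckendorf (fib_digits N).
  move=> i; have := Z' i; have := d01 i; have := d01 i.+1; lia.
have [m Sm] : exists m, forall i, m <= i -> fib_digits N i = 0.
  have [B BE] := (finite_seqP _).1 fin.
  exists (\max_(i <- B) i).+1 => i lei; apply/eqP/negPn/negP => /eqP Ni.
  have iB : i \in B by have : [set` B]%classic i by rewrite -BE.
  by have := @leq_bigmax_seq _ B xpredT id i iB isT; lia.
have SN n : N < fib n -> forall i, n <= i -> fib_digits N i = 0.
  move=> ltN i lei; have [lemi|ltim] := leqP m i; first exact: Sm.
  have := d01 i => -[//|di]; suff : fib i <= N by have := fib_homo lei; lia.
  rewrite VE (fib_valueE Sm) /fib_sum (bigD1 (Ordinal ltim)) //= di mul1n.
  exact: leq_addr.
by split=> // n ltN; rewrite {2}VE (fib_valueE (SN n ltN)).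
Qed.

Lemma fib_digits_fib_sum eps n : zeckendorf eps ->
  (forall i, n <= i -> eps i = 0) -> fib_digits (fib_sum n eps) = eps.
Proof.
move=> Z S; have ltn := fib_sum_lt n Z; have [Z' S' E] := fib_digitsP (fib_sum n eps).
apply/funext => i; have [lei|lti] := leqP n i.
  by rewrite S // (S' n).
exact: (fib_sum_inj Z' Z (E n ltn)).
Qed.

Lemma zeckendorf_digits N : zeckendorf (fib_digits N).
Proof. by have [] := fib_digitsP N. Qed.

Lemma fib_digits_out N n : N < fib n -> forall i, n <= i -> fib_digits N i = 0.
Proof. by move=> ltN; have [_ /(_ _ ltN) + _] := fib_digitsP N; apply. Qed.

Lemma fib_sum_digits N n : N < fib n -> fib_sum n (fib_digits N) = N.
Proof. by have [_ _] := fib_digitsP N; apply. Qed.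

Lemma fib_digits_le1 N i : fib_digits N i <= 1.
Proof. by have := zeckendorf_digits N i; lia. Qed.

(** * One step of the machine *)

(** Both digit rules become one when positions are shifted by s = eps_0: draw j
    interrogates the digit at position 2j + 1 - s, and the carry goes on if this
    digit is 1. *)
Definition carry_pos N j := j.*2.+1 - fib_digits N 0.

(** The carry digits are 1 for j < height, and height is the number of digits
    that adding 1 to N erases. *)
Definition height N := run (fun j => fib_digits N (carry_pos N j) == 1) N.+1.

(** The index of the first failed draw; draws after number [height N] have no
    effect. *)
Definition stage N (e : nat -> bool) := run e (height N).+1.

Definition top_pos N := (height N).*2 - fib_digits N 0.

(** At stage j the digits below 2j - s have been erased; if no draw fails, a 1
    is moreover written at [top_pos N], and the new state is N + 1. *)
Definition outcome_digits N j i :=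
  if (j == (height N).+1) && (i == top_pos N) then 1
  else if i < j.*2 - fib_digits N 0 then 0 else fib_digits N i.

Definition outcome N j := fib_value (outcome_digits N j).

Lemma height_le N : height N <= N.
Proof.
have := run_le (fun j => fib_digits N (carry_pos N j) == 1) N.+1.
rewrite leq_eqVlt ltnS -/(height N) => /predU1P[hN|//].
have := @lt_run (fun j => fib_digits N (carry_pos N j) == 1) N.+1 N.
rewrite -/(height N) hN => /(_ (ltnSn N)).
rewrite (@fib_digits_out N N) ?fib_gt //.
by rewrite /carry_pos; have := fib_digits_le1 N 0; lia.
Qed.

Lemma digit_carry N j : j < height N -> fib_digits N (carry_pos N j) = 1.
Proof. by move/lt_run/eqP. Qed.

Lemma digit_height N : fib_digits N (carry_pos N (height N)) = 0.
Proof.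
have /run_stop : height N < N.+1 by rewrite ltnS height_le.
by rewrite -/(height N); have := fib_digits_le1 N (carry_pos N (height N)); lia.
Qed.

Lemma height_gt0 N : fib_digits N 0 = 1 -> 0 < height N.
Proof.
move=> d0; rewrite lt0n; apply/eqP => h0; have := digit_height N.
by rewrite h0 /carry_pos d0 subnn d0.
Qed.

(** Below its top position N is alternating, 1 at the carry positions and 0 in
    between, so that this part of N is F_(top_pos N) - 1. *)
Lemma digit_below N i : i < top_pos N ->
  fib_digits N i = odd (i + fib_digits N 0).
Proof.
rewrite /top_pos => lti; have d1 := fib_digits_le1 N 0.
have carry k : k < height N -> fib_digits N (k.*2.+1 - fib_digits N 0) = 1.
  exact: digit_carry.
set s := fib_digits N 0 in lti d1 carry *.
have E := odd_double_half (i + s).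
case O: (odd (i + s)) in E *.
  have := carry (i + s)./2; rewrite (_ : _.*2.+1 - s = i); last by lia.
  by apply; lia.
have := carry (i + s)./2; rewrite (_ : _.*2.+1 - s = i.+1); last by lia.
by have := zeckendorf_digits N i; lia.
Qed.

(** A draw is a success exactly if the stage is larger, as long as the carry can
    get there. *)
Lemma lt_stage N e i : i <= height N -> i <= stage N e ->
  (e i : nat) = (i < stage N e).
Proof.
move=> leh leJ; case: ltnP => [/lt_run-> //|leJ'].
have -> : i = stage N e by apply/eqP; rewrite eqn_leq leJ.
have : stage N e < (height N).+1 by apply: leq_ltn_trans leJ' _.
by move/run_stop/negbTE => ->.
Qed.

Lemma stage_le N e : stage N e <= (height N).+1.
Proof. exact: run_le. Qed.

Lemma carry0E N (e : nat -> bool) i : fib_digits N 0 = 0 ->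
  carry0 (fib_digits N) e i = (i <= stage N e) && (i <= height N).
Proof.
move=> d0; elim: i => [|i IH] //=; rewrite IH.
have [leh|lth] := leqP i (height N); last by rewrite !andbF muln0; lia.
have [leJ|ltJ] := leqP i (stage N e); last by rewrite muln0; lia.
rewrite (lt_stage leh leJ) muln1.
move: leh; rewrite leq_eqVlt => /predU1P[->|lth].
  have := digit_height N; rewrite /carry_pos d0 subn0 => ->.
  by rewrite muln0 ltnn andbF.
by have := digit_carry lth; rewrite /carry_pos d0 subn0 => ->; rewrite lth andbT muln1.
Qed.

Lemma carry0M N (e : nat -> bool) i : fib_digits N 0 = 0 ->
  e i * carry0 (fib_digits N) e i = (i < stage N e).
Proof.
move=> d0; rewrite carry0E //; have := stage_le N e.
have [leh|lth] := leqP i (height N); last by rewrite andbF muln0; lia.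
have [leJ|ltJ] := leqP i (stage N e); last by rewrite muln0; lia.
by rewrite (lt_stage leh leJ) muln1.
Qed.

Lemma carry1E N (e : nat -> bool) i : fib_digits N 0 = 1 ->
  carry1 (fib_digits N) e i = (i < stage N e) && (i < height N).
Proof.
move=> d0; have h0 := height_gt0 d0; elim: i => [|i IH] /=.
  by rewrite h0 andbT; apply: lt_stage.
rewrite IH.
have [lth|leh] := ltnP i (height N); last by rewrite !andbF muln0; lia.
have [ltJ|leJ] := ltnP i (stage N e); last by rewrite muln0; lia.
rewrite (lt_stage lth ltJ) muln1.
move: lth; rewrite leq_eqVlt => /predU1P[ih|lth].
  have := digit_height N; rewrite /carry_pos d0 subn1 /= -ih => ->.
  by rewrite muln0 ltnn andbF.
have := digit_carry lth; rewrite /carry_pos d0 subn1 /= => ->.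
by rewrite lth andbT muln1.
Qed.

Lemma carry1M N (e : nat -> bool) i : fib_digits N 0 = 1 ->
  e i.+1 * carry1 (fib_digits N) e i = (i.+1 < stage N e).
Proof.
move=> d0; rewrite carry1E //; have := stage_le N e.
have [lth|leh] := ltnP i (height N); last by rewrite andbF muln0; lia.
have [ltJ|leJ] := ltnP i (stage N e); last by rewrite muln0; lia.
by rewrite (lt_stage lth ltJ) muln1.
Qed.

Lemma digit_top N : fib_digits N (top_pos N) = 0.
Proof.
rewrite /top_pos.
have [h0|h0] := posnP (height N).
  rewrite h0 double0 sub0n; apply/eqP/negPn/negP => d0.
  by have := @height_gt0 N; have := fib_digits_le1 N 0; lia.
have := @digit_carry N (height N).-1; rewrite prednK // leqnn => /(_ isT).
have := zeckendorf_digits N (carry_pos N (height N).-1).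
have -> : (carry_pos N (height N).-1).+1 = (height N).*2 - fib_digits N 0.
  by rewrite /carry_pos; have := fib_digits_le1 N 0; lia.
lia.
Qed.

Lemma next_digits0E N e : fib_digits N 0 = 0 ->
  next_digits0 (fib_digits N) e =1 outcome_digits N (stage N e).
Proof.
move=> d0 m; rewrite /next_digits0 mulnAC carry0M // mulnC.
rewrite /outcome_digits /top_pos d0 !subn0; have E := odd_double_half m.
have := stage_le N e; set J := stage N e; set k := height N => leJ.
set i := m./2 in E *.
have top := digit_top N; rewrite /top_pos d0 subn0 in top.
have topS := digit_height N; rewrite /carry_pos d0 subn0 in topS.
have below l : l < k.*2 -> fib_digits N l = odd l.
  by move=> ltl; rewrite digit_below /top_pos d0 ?subn0 ?addn0.
have [ltiJ|leJi] := ltnP i J; last first.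
  rewrite /= ?muln0 ?addn0 (_ : _ && _ = false); last by lia.
  rewrite (_ : (m < J.*2) = false); last by lia.
  case: (odd m) E => E; rewrite divn1; congr fib_digits; lia.
case: (odd m) E => E.
  rewrite divn_small; last by have := fib_digits_le1 N i.*2.+1; lia.
  have -> : (J == k.+1) && (m == k.*2) = false by lia.
  by have -> : m < J.*2 by lia.
rewrite muln1; have [ik|ik] := eqVneq i k.
  have -> : (J == k.+1) && (m == k.*2) by lia.
  by rewrite ik topS top.
have -> : (J == k.+1) && (m == k.*2) = false by lia.
have -> : m < J.*2 by lia.
have lik : i < k by lia.
have E1 : fib_digits N i.*2.+1 = 1 by rewrite below ?oddS ?odd_double //; lia.
have E0 : fib_digits N i.*2 = 0 by rewrite below ?odd_double //; lia.
by rewrite E1 E0.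
Qed.

Lemma next_digits1E N e : fib_digits N 0 = 1 ->
  next_digits1 (fib_digits N) e =1 outcome_digits N (stage N e).
Proof.
move=> d0 m; rewrite /next_digits1 /outcome_digits /top_pos d0.
have k_gt0 := height_gt0 d0.
have top := digit_top N; rewrite /top_pos d0 in top.
have topS := digit_height N; rewrite /carry_pos d0 subn1 /= in topS.
have e0 := @lt_stage N e 0 (leq0n _) (leq0n _).
have := stage_le N e; set J := stage N e in e0 *; set k := height N in k_gt0 *.
move=> leJ.
have below l : l < k.*2 - 1 -> fib_digits N l = odd l.+1.
  by move=> ltl; rewrite digit_below /top_pos d0 ?addn1.
case: m => [|h].
  rewrite e0 (_ : _ && _ = false); last by lia.
  by rewrite d0; case: (posnP J) => [->|J0] //=; rewrite (_ : _ < _ - _ = true) //; lia.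
have E := odd_double_half h; set i := h./2 in E *.
rewrite mulnAC carry1M // -/J.
have [ltiJ|leJi] := ltnP i.+1 J; last first.
  rewrite /= ?mul0n ?addn0 (_ : _ && _ = false); last by lia.
  rewrite (_ : (_ < _ - _) = false); last by lia.
  case: (odd h) E => E; rewrite divn1; congr fib_digits; lia.
case: (odd h) E => E.
  rewrite divn_small; last by have := fib_digits_le1 N i.+1.*2; lia.
  have -> : (J == k.+1) && (h.+1 == k.*2 - 1) = false by lia.
  by have -> : h.+1 < J.*2 - 1 by lia.
rewrite mul1n; have [ik|ik] := eqVneq i.+1 k.
  have -> : (J == k.+1) && (h.+1 == k.*2 - 1) by lia.
  rewrite ik topS; have -> : i.*2.+1 = k.*2 - 1 by lia.
  by rewrite top.
have -> : (J == k.+1) && (h.+1 == k.*2 - 1) = false by lia.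
have -> : h.+1 < J.*2 - 1 by lia.
have lik : i.+1 < k by lia.
have E1 : fib_digits N i.+1.*2 = 1 by rewrite below ?oddS ?odd_double //; lia.
have E0 : fib_digits N i.*2.+1 = 0 by rewrite below ?oddS ?odd_double //; lia.
by rewrite E1 E0.
Qed.

(** A step is a function of the state and of the stage alone. *)
Lemma fib_stepE N e : fib_step e N = outcome N (stage N e).
Proof.
rewrite /fib_step /outcome; congr fib_value; apply/funext => m.
have [d0|d0] : fib_digits N 0 = 0 \/ fib_digits N 0 = 1.
- by have := fib_digits_le1 N 0; lia.
- by rewrite d0; exact: next_digits0E.
- by rewrite d0; exact: next_digits1E.
Qed.

Lemma top_pos_le N : top_pos N <= N.
Proof.
rewrite /top_pos; have [->|h0] := posnP (height N); first by lia.
have := @digit_carry N (height N).-1; rewrite prednK // leqnn => /(_ isT).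
have [leN|] := leqP N (carry_pos N (height N).-1).
  by rewrite (fib_digits_out (fib_gt N)).
by rewrite /carry_pos; have := fib_digits_le1 N 0; lia.
Qed.

Lemma outcome_digits_out N j i : N < i -> outcome_digits N j i = 0.
Proof.
move=> ltNi; rewrite /outcome_digits (fib_digits_out (fib_gt N) (ltnW ltNi)).
have -> : i == top_pos N = false.
  by have := top_pos_le N; lia.
by rewrite andbF; case: ifP.
Qed.

Lemma outcome_digits_zeckendorf N j : zeckendorf (outcome_digits N j).
Proof.
move=> i; have := zeckendorf_digits N i; have d1 := fib_digits_le1 N 0.
have h_gt0 := @height_gt0 N; rewrite /outcome_digits /top_pos => Z.
have [jT|jT] := eqVneq j (height N).+1; last by rewrite /=; do 2!case: ltnP => _ //=; lia.
rewrite jT /=; have [iT|iT] := eqVneq i ((height N).*2 - fib_digits N 0).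
  have -> : (i.+1 == (height N).*2 - fib_digits N 0) = false by lia.
  by have -> : i.+1 < (height N).+1.*2 - fib_digits N 0 by lia.
have [iT'|iT'] := eqVneq i.+1 ((height N).*2 - fib_digits N 0).
  by have -> : i < (height N).+1.*2 - fib_digits N 0 by lia.
by do 2!case: ltnP => _ //=; lia.
Qed.

Lemma fib_digits_outcome N j : fib_digits (outcome N j) = outcome_digits N j.
Proof.
have S i : N < i -> outcome_digits N j i = 0 by exact: outcome_digits_out.
by rewrite /outcome (fib_valueE S) fib_digits_fib_sum //; exact: outcome_digits_zeckendorf.
Qed.

Lemma outcome0 N : outcome N 0 = N.
Proof.
rewrite /outcome (_ : outcome_digits N 0 = fib_digits N).
  by rewrite (fib_valueE (fib_digits_out (fib_gt N))) fib_sum_digits ?fib_gt.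
by apply/funext => i; rewrite /outcome_digits double0 sub0n.
Qed.

Local Open Scope ring_scope.

(** * Digit weights *)

(** Additive functions of the digits; [fib] itself gives back the state, and the
    mean climbing times will give the clock of the chain. *)
Definition digit_weight (V : nmodType) (g : nat -> V) (N : nat) : V :=
  \sum_(i < N) g i *+ fib_digits N i.

Lemma digit_weightE (V : nmodType) (g : nat -> V) N n :
  (forall i, (n <= i)%N -> fib_digits N i = 0%N) ->
  digit_weight g N = \sum_(i < n) g i *+ fib_digits N i.
Proof.
move=> S; rewrite /digit_weight.
pose F i := g i *+ fib_digits N i.
suff widen a b : (forall i, (a <= i)%N -> fib_digits N i = 0%N) -> (a <= b)%N ->
    \sum_(i < b) F i = \sum_(i < a) F i.
  have SN := fib_digits_out (fib_gt N).
  have [leNn|/ltnW lenN] := leqP N n.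
    by rewrite (widen N n) // => i; apply: fib_digits_out (fib_gt N).
  by rewrite (widen n N).
move=> Sa leab; rewrite -(subnKC leab) big_split_ord /= [X in _ + X]big1 ?addr0 //.
by move=> i _; rewrite /F Sa ?leq_addr // mulr0n.
Qed.

Lemma digit_weight_fib N : digit_weight fib N = N.
Proof.
rewrite -[RHS](fib_sum_digits (fib_gt N)); apply: eq_bigr => i _.
by elim: (fib_digits N i) => // n IH; rewrite mulrS IH.
Qed.

(** Two outcomes that differ only in the digit at position c. *)
Lemma digit_weight_change (V : nmodType) (g : nat -> V) N j j' c : (c <= N)%N ->
  (forall i, outcome_digits N j i = ((i == c) + outcome_digits N j' i)%N) ->
  digit_weight g (outcome N j) = g c + digit_weight g (outcome N j').
Proof.
move=> lec E; have S l i : (N.+1 <= i)%N -> fib_digits (outcome N l) i = 0%N.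
  by move=> lti; rewrite fib_digits_outcome outcome_digits_out.
rewrite !(digit_weightE _ (S _)) (eq_bigr (fun i : 'I_N.+1 =>
    g i *+ (val i == c) + g i *+ fib_digits (outcome N j') i)) => [|i _].
  rewrite big_split /=; congr (_ + _).
  rewrite (bigD1 (Ordinal (lec : c < N.+1)%N)) //= eqxx mulr1n big1 ?addr0 // => i.
  by rewrite -val_eqE /= => /negbTE ->.
by rewrite !fib_digits_outcome E mulrnDr.
Qed.

(** Passing one more stage erases exactly one nonzero digit. *)
Lemma weight_carry (V : nmodType) (g : nat -> V) N j : (j < height N)%N ->
  digit_weight g (outcome N j) =
  g (carry_pos N j) + digit_weight g (outcome N j.+1).
Proof.
move=> ltj; have dj := digit_carry ltj; apply: digit_weight_change => [|i].
  apply: ltnW; rewrite ltnNge; apply/negP => leN.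
  by move: dj; rewrite (fib_digits_out (fib_gt N)).
rewrite /outcome_digits.
have -> : (j == (height N).+1) = false by lia.
have -> : (j.+1 == (height N).+1) = false by lia.
have d1 := fib_digits_le1 N 0; move: dj; rewrite /carry_pos /= => dj.
have [->|ic] := eqVneq i (j.*2.+1 - fib_digits N 0)%N.
  rewrite dj; have -> : (j.*2.+1 - fib_digits N 0 < j.*2 - fib_digits N 0)%N = false by lia.
  by have -> : (j.*2.+1 - fib_digits N 0 < j.+1.*2 - fib_digits N 0)%N by lia.
rewrite add0n; have [lti|gei] := ltnP i (j.*2 - fib_digits N 0).
  by have -> : (i < j.+1.*2 - fib_digits N 0)%N by lia.
case: ltnP => // lti; rewrite digit_below; last by rewrite /top_pos; lia.
have -> : i = (j.*2 - fib_digits N 0)%N by lia.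
have [d0|d0] : fib_digits N 0 = 0%N \/ fib_digits N 0 = 1%N by lia.
  by rewrite d0 subn0 addn0 odd_double.
have j0 : (0 < j)%N by lia.
by rewrite subnK ?odd_double //; lia.
Qed.

Lemma weight_top (V : nmodType) (g : nat -> V) N :
  digit_weight g (outcome N (height N).+1) =
  g (top_pos N) + digit_weight g (outcome N (height N)).
Proof.
apply: digit_weight_change (top_pos_le N) _ => i.
have top := digit_top N; have topS := digit_height N.
have d1 := fib_digits_le1 N 0.
rewrite /outcome_digits eqxx (ltn_eqF (ltnSn _)) /=.
have [->|it] := eqVneq i (top_pos N).
  by rewrite ltnn top.
rewrite add0n; case: ltnP => lti; case: ltnP => // lti'.
- rewrite (_ : i = carry_pos N (height N)) ?topS //.
  by move: it lti lti'; rewrite /carry_pos /top_pos; lia.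
- by move: lti lti'; rewrite /top_pos; lia.
Qed.

Lemma weight_outcome (V : nmodType) (g : nat -> V) N j : (j <= height N)%N ->
  digit_weight g N =
  \sum_(i < j) g (carry_pos N i) + digit_weight g (outcome N j).
Proof.
elim: j => [|j IH] ltj; first by rewrite big_ord0 add0r outcome0.
by rewrite IH 1?ltnW // big_ord_recr /= -addrA -weight_carry.
Qed.

(** F_1 + F_3 + ... + F_(2k-1) = F_(2k) - 1 and
    F_0 + F_2 + ... + F_(2k-2) = F_(2k-1) - 1, according to the parity of the
    top position. *)
Lemma fib_carry N :
  (\sum_(i < height N) fib (carry_pos N i)).+1 = fib (top_pos N).
Proof.
rewrite /top_pos /carry_pos; have := @height_gt0 N; have := fib_digits_le1 N 0.
case: (fib_digits N 0) => [|[|//]] _.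
  move=> _; rewrite subn0; elim: (height N) => [|k IH]; first by rewrite big_ord0.
  by rewrite big_ord_recr /= -addSn IH subn0 doubleS fibSS addnC.
move=> /(_ erefl); case: (height N) => // k _.
rewrite (_ : (k.+1.*2 - 1 = k.*2.+1)%N); last by lia.
rewrite (eq_bigr (fun i : 'I_k.+1 => fib i.*2)) => [|i _]; last by rewrite subn1.
elim: k => [|k IH]; first by rewrite big_ord_recr big_ord0.
by rewrite big_ord_recr /= -addSn IH doubleS fibSS addnC.
Qed.

Lemma outcome_le N j : (j <= height N)%N -> (outcome N j <= N)%N.
Proof.
move=> /(weight_outcome fib); rewrite !digit_weight_fib => {2}->.
exact: leq_addl.
Qed.

Lemma outcome_succ N : outcome N (height N).+1 = N.+1.
Proof.
rewrite -[LHS]digit_weight_fib weight_top -fib_carry.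
by rewrite -[in RHS](digit_weight_fib N) (weight_outcome fib (leqnn (height N))).
Qed.

Lemma outcome_leS N j : (j <= (height N).+1)%N -> (outcome N j <= N.+1)%N.
Proof.
rewrite leq_eqVlt => /predU1P[->|]; first by rewrite outcome_succ.
by rewrite ltnS => /outcome_le/leqW.
Qed.

(** Stage j constrains finitely many draws: successes before j, and a failure at
    j unless the carry goes all the way. *)
Lemma stage_eqP N (f : nat -> bool) j : (j <= (height N).+1)%N ->
  (stage N f == j) = all (fun i => f i == (i < j)%N) (iota 0 (minn j (height N)).+1).
Proof.
move=> lej; apply/eqP/allP => [<- i|h].
  rewrite mem_iota /= add0n ltnS leq_min => /andP[leJ leh].
  by have := lt_stage leh leJ; case: (f i); case: ltnP.
apply/eqP; rewrite eqn_leq; apply/andP; split; rewrite leqNgt; apply/negP => ltJ.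
  have leh : (j <= height N)%N by rewrite -ltnS; apply: leq_trans ltJ (stage_le N f).
  have /h : j \in iota 0 (minn j (height N)).+1 by rewrite mem_iota /= add0n ltnS leq_min leqnn leh.
  by rewrite ltnn (lt_run ltJ).
have ltk : (stage N f < (height N).+1)%N by apply: leq_trans ltJ lej.
have /h : stage N f \in iota 0 (minn j (height N)).+1.
  by rewrite mem_iota /= add0n ltnS leq_min (ltnW ltJ) -ltnS.
by rewrite ltJ; move/negbTE: (run_stop ltk) => ->.
Qed.

Lemma fib_step_le f N : (fib_step f N <= N.+1)%N.
Proof. by rewrite fib_stepE outcome_leS ?stage_le. Qed.

(** The level of N is n + 1 for F_n <= N < F_(n+1), and 0 for N = 0. *)
Definition level N := run (fun n => (fib n <= N)%N) N.+1.

Arguments level : simpl never.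

Lemma level_le N n : (N < fib n)%N -> (level N <= n)%N.
Proof. by move=> ltN; rewrite leqNgt; apply/negP => /lt_run; rewrite leqNgt ltN. Qed.

Lemma fib_level N : (N < fib (level N))%N.
Proof.
have [ltl|] := ltnP (level N) N.+1; first by rewrite ltnNge; exact: run_stop ltl.
by move=> /(@lt_run (fun n => (fib n <= N)%N)); rewrite leqNgt fib_gt.
Qed.

Lemma level_fib n : level (fib n) = n.+1.
Proof.
apply/eqP; rewrite eqn_leq level_le.
  by rewrite ltnNge; apply/negP => /fib_homo; rewrite leqNgt fib_level.
by case: n => // n; rewrite fibSS; have := fib_gt n; lia.
Qed.

Lemma level_homo : {homo level : M N / (M <= N)%N}.
Proof. by move=> M N leMN; apply/level_le/(leq_ltn_trans leMN)/fib_level. Qed.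

Lemma level0 : level 0 = 0%N. Proof. by apply/eqP; rewrite -leqn0 level_le. Qed.

(** N + 1 leaves the level of N only if N = F_n - 1.  The last failure then
    resets the chain to 0, since N + 1 = F_n has a single nonzero digit, the one
    written at the top position. *)
Lemma top_pos_full N : N.+1 = fib (level N) ->
  top_pos N = level N /\ outcome N (height N) = 0%N.
Proof.
move=> EN; have topE : top_pos N = level N.
  have : fib_digits (outcome N (height N).+1) (top_pos N) = 1%N.
    by rewrite fib_digits_outcome /outcome_digits !eqxx.
  rewrite outcome_succ EN.
  (* The expansion of the Fibonacci number itself. *)
  pose delta i := (i == level N : nat).
  have -> : fib (level N) = fib_sum (level N).+1 delta.
    rewrite /fib_sum big_ord_recr /= /delta eqxx mul1n big1 // => i _.
    by rewrite ltn_eqF.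
  rewrite fib_digits_fib_sum.
  - by rewrite /delta; case: eqP.
  - by move=> i; rewrite /delta; lia.
  - by move=> i; rewrite /delta; lia.
split=> //; have := weight_top fib N.
by rewrite outcome_succ !digit_weight_fib topE EN; lia.
Qed.

(** * Mean effect of one step *)
Section expectation.
Variables (R : realFieldType) (p : nat -> R).

Definition survival n := \prod_(j < n) p j.+1.

Definition outcome_prob N j :=
  survival j * (if (j <= height N)%N then 1 - p j.+1 else 1).

Definition expect N (f : nat -> R) :=
  \sum_(j < (height N).+2) outcome_prob N j * f (outcome N j).

Lemma survivalS n : survival n.+1 = survival n * p n.+1.
Proof. by rewrite /survival big_ord_recr. Qed.

(** Abel summation: it replaces the law of the stage by the probabilities
    [survival] of passing it, and values by their increments. *)
Lemma telescope (x : nat -> R) n :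
  \sum_(j < n) survival j * (1 - p j.+1) * x j + survival n * x n =
  x 0%N + \sum_(j < n) survival j.+1 * (x j.+1 - x j).
Proof.
elim: n => [|n IH].
  by rewrite !big_ord0 /survival big_ord0 mul1r add0r addr0.
rewrite !big_ord_recr /= addrA -IH survivalS; ring.
Qed.

Lemma expectE N f : expect N f =
  \sum_(j < (height N).+1) survival j * (1 - p j.+1) * f (outcome N j) +
  survival (height N).+1 * f N.+1.
Proof.
rewrite /expect big_ord_recr /= outcome_succ /outcome_prob ltnn mulr1.
by congr (_ + _); apply: eq_bigr => -[j ltj] _ /=; rewrite -ltnS ltj.
Qed.

Lemma expect_telescope N f : expect N f = f N +
  \sum_(j < (height N).+1) survival j.+1 *
    (f (outcome N j.+1) - f (outcome N j)).
Proof.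
have := telescope (fun j => f (outcome N j)) (height N).+1.
by rewrite /= outcome_succ outcome0 expectE => ->.
Qed.

Lemma expect_cst N a : expect N (fun=> a) = a.
Proof.
rewrite expect_telescope big1 ?addr0 // => j _.
by rewrite subrr mulr0.
Qed.

Lemma expectD N f g : expect N (fun M => f M + g M) = expect N f + expect N g.
Proof. by rewrite /expect -big_split; apply: eq_bigr => j _; rewrite mulrDr. Qed.

Lemma expectN N f : expect N (fun M => - f M) = - expect N f.
Proof. by rewrite /expect -sumrN; apply: eq_bigr => j _; rewrite mulrN. Qed.

End expectation.

(** * Climbing times and the potential *)
Section lyapunov.
Variables (R : realType) (p : nat -> R).
Hypothesis p01 : probability_sequence p.

Lemma p_gt0 n : 0 < p n.+1.
Proof. by have /andP[] := p01 (ltn0Sn n). Qed.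

Lemma p_le1 n : p n.+1 <= 1.
Proof. by have /andP[] := p01 (ltn0Sn n). Qed.

Lemma survival_gt0 n : 0 < survival p n.
Proof. by apply: prodr_gt0 => j _; exact: p_gt0. Qed.

Lemma outcome_prob_ge0 N j : 0 <= outcome_prob p N j.
Proof.
rewrite mulr_ge0 ?(ltW (survival_gt0 _)) //.
by case: ifP => // _; rewrite subr_ge0 p_le1.
Qed.

Lemma ler_expect N f g : (forall M, (M <= N.+1)%N -> f M <= g M) ->
  expect p N f <= expect p N g.
Proof.
move=> lefg; apply: ler_sum => j _.
apply: ler_wpM2l; first exact: outcome_prob_ge0.
by apply: lefg; rewrite outcome_leS // -ltnS.
Qed.

(** The probability that the carry, once it has erased everything below the
    leading digit of F_n - 1, also gets through to F_n: this last draw is number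
    ceil(n/2). *)
Definition pass n := p (uphalf n).+1.

(** The probability of reaching F_n from 0 before returning to 0, where staying
    at 0 counts as a return. *)
Definition reach n := p 1 * \prod_(i < n) pass i.+1.

(** The products of [reach n] and the mean time to reach F_n from 0.  Unlike the
    times themselves they satisfy a recursion without division. *)
Fixpoint scaled_time n : R :=
  match n with
  | 0 => 1
  | m.+1 => match m with
            | 0 => 2
            | k.+1 => scaled_time m + pass k.+1 * scaled_time k
            end
  end.

(** The mean time to reach F_n from 0. *)
Definition climb_time n := scaled_time n / reach n.

Lemma pass_gt0 n : 0 < pass n. Proof. exact: p_gt0. Qed.
Lemma pass_le1 n : pass n <= 1. Proof. exact: p_le1. Qed.

Lemma reachS n : reach n.+1 = reach n * pass n.+1.
Proof. by rewrite /reach big_ord_recr mulrA. Qed.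

Lemma reach0 : reach 0 = p 1.
Proof. by rewrite /reach big_ord0 mulr1. Qed.

Lemma reach_gt0 n : 0 < reach n.
Proof.
by rewrite mulr_gt0 ?p_gt0 //; apply: prodr_gt0 => i _; exact: pass_gt0.
Qed.

Lemma scaled_timeSS n :
  scaled_time n.+2 = scaled_time n.+1 + pass n.+1 * scaled_time n.
Proof. by []. Qed.

Lemma scaled_time_gt0 n : 0 < scaled_time n.
Proof.
elim/ltn_ind: n => -[|[|n]] IH //.
by rewrite scaled_timeSS addr_gt0 ?mulr_gt0 ?pass_gt0 ?IH.
Qed.

Lemma climb_time_gt0 n : 0 < climb_time n.
Proof. by rewrite divr_gt0 ?scaled_time_gt0 ?reach_gt0. Qed.

Lemma climb_time0 : p 1 * climb_time 0 = 1.
Proof. by rewrite /climb_time reach0 mul1r divff ?gt_eqF ?p_gt0. Qed.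

Lemma pass_climb_time n :
  pass n.+1 * climb_time n.+1 = scaled_time n.+1 / reach n.
Proof.
have r0 := lt0r_neq0 (reach_gt0 n); have p0 := lt0r_neq0 (pass_gt0 n.+1).
by rewrite /climb_time reachS; field; apply/andP.
Qed.

Lemma climb_time1 : pass 1 * climb_time 1 = climb_time 0 *+ 2.
Proof. by rewrite pass_climb_time /climb_time /= mul1r mulr_natl. Qed.

(** The chain reaches F_(n+1), then runs below F_n on top of it; after that it
    gets through to F_(n+2) with probability [pass n.+2] or restarts at 0. *)
Lemma climb_timeSS n :
  pass n.+2 * climb_time n.+2 = climb_time n.+1 + climb_time n.
Proof.
have r0 := lt0r_neq0 (reach_gt0 n); have p0 := lt0r_neq0 (pass_gt0 n.+1).
rewrite pass_climb_time scaled_timeSS /climb_time reachS.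
by field; apply/andP.
Qed.

(** With k the height, p_(k+1) times the climbing time at the top position is
    the sum of those at the two positions below, the upper one being that of the
    last carry digit.  Hence the sum telescopes, and p_1 G_0 = 1 is left over. *)
Lemma climb_time_carry N :
  \sum_(i < height N) survival p i.+1 * climb_time (carry_pos N i) + 1 =
  survival p (height N).+1 * climb_time (top_pos N).
Proof.
have surv1 : survival p 1 * climb_time 0 = 1.
  by rewrite /survival big_ord_recr big_ord0 /= mul1r climb_time0.
rewrite /top_pos /carry_pos; have := @height_gt0 N; have := fib_digits_le1 N 0.
case: (fib_digits N 0) => [|[|//]] _.
  move=> _; rewrite subn0.
  rewrite (eq_bigr (fun i : 'I_(height N) => survival p i.+1 * climb_time i.*2.+1)).
    elim: (height N) => [|k IH]; first by rewrite big_ord0 add0r surv1.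
    rewrite big_ord_recr /= addrAC IH (survivalS p k.+1) doubleS.
    rewrite -mulrA (_ : p k.+2 = pass k.*2.+2) ?climb_timeSS; first by ring.
    by rewrite /pass /= uphalf_double.
  by move=> i _; rewrite subn0.
move=> /(_ erefl); case: (height N) => // k _.
rewrite (_ : (k.+1.*2 - 1 = k.*2.+1)%N); last by lia.
rewrite (eq_bigr (fun i : 'I_k.+1 => survival p i.+1 * climb_time i.*2)) => [|i _];
  last by rewrite subn1.
have passE j : p j.+2 = pass j.*2.+1 by rewrite /pass /= doubleK.
elim: k => [|k IH].
  rewrite big_ord_recr big_ord0 /= add0r (survivalS p 1) -mulrA passE.
  by rewrite climb_time1 mulrnAr surv1 mulr2n.
rewrite big_ord_recr /= addrAC IH (survivalS p k.+2) -mulrA passE doubleS climb_timeSS.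
by ring.
Qed.

(** The clock: the weight of the state grows by one in mean at each step. *)
Lemma expect_time N :
  expect p N (digit_weight climb_time) = digit_weight climb_time N + 1.
Proof.
rewrite expect_telescope; congr (_ + _).
rewrite big_ord_recr /= weight_top addrK -climb_time_carry addrA -[RHS]add0r.
congr (_ + _); rewrite -big_split big1 // => j _ /=.
by rewrite (weight_carry _ (ltn_ord j)); ring.
Qed.

Lemma climb_time_le n : climb_time n <= climb_time n.+1.
Proof.
have t0 := climb_time_gt0 n; have t1 := climb_time_gt0 n.+1.
apply: le_trans (_ : pass n.+1 * climb_time n.+1 <= _); last first.
  by rewrite ler_piMl ?pass_le1 // ltW.
case: n t0 {t1} => [|n] t0; first by rewrite climb_time1; lra.
by rewrite climb_timeSS; have := climb_time_gt0 n; lra.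
Qed.

Lemma climb_time_add n : climb_time n.+1 + climb_time n <= climb_time n.+2.
Proof. by rewrite -climb_timeSS ler_piMl ?pass_le1 // ltW ?climb_time_gt0. Qed.

Lemma sum_climb_time_le eps n : zeckendorf eps ->
  \sum_(i < n) climb_time i *+ eps i <= climb_time n.
Proof.
move=> Z; elim/ltn_ind: n => -[|[|n]] IH.
- by rewrite big_ord0 ltW ?climb_time_gt0.
- rewrite big_ord_recr big_ord0 /= add0r.
  have := climb_time_le 0; have := climb_time_gt0 0.
  by have := Z 0%N; case: (eps 0%N) => [|[|]] //; rewrite ?mulr0n ?mulr1n; lra.
have := IH n.+1 (ltnSn _); have := IH n (leqnSn _).
have := climb_time_add n; have := climb_time_le n.+1; have := Z n.
rewrite !big_ord_recr /=.
case: (eps n.+1) => [|[|m]]; case: (eps n) => [|[|l]] //=;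
  rewrite ?mulr0n ?mulr1n; lra.
Qed.

(** A top digit 1 is followed by a 0 and an expansion of length n - 1, so the
    weight is at most G_n + G_(n-1). *)
Lemma sum_climb_time_leS eps n : zeckendorf eps ->
  \sum_(i < n.+1) climb_time i *+ eps i <= pass n.+1 * climb_time n.+1.
Proof.
move=> Z; case: n => [|n].
  rewrite big_ord_recr big_ord0 /= add0r climb_time1.
  have := climb_time_gt0 0.
  by have := Z 0%N; case: (eps 0%N) => [|[|]] //; rewrite ?mulr0n ?mulr1n; lra.
have := sum_climb_time_le n Z; have := sum_climb_time_le n.+1 Z.
rewrite climb_timeSS !big_ord_recr /=; have := Z n.
have := climb_time_gt0 n; have := climb_time_gt0 n.+1.
case: (eps n.+1) => [|[|m]]; case: (eps n) => [|[|l]] //=;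
  rewrite ?mulr0n ?mulr1n; lra.
Qed.

(** Climbing from level n to level n + 1 divides the value by [pass n], so that
    climbing with this probability and falling to 0 otherwise does not change
    the mean. *)
Definition ladder c l := if l is n.+1 then c / reach n else 0.

Lemma ladder_homo c : 0 <= c -> {homo ladder c : m n / (m <= n)%N >-> m <= n}.
Proof.
move=> c0; apply: homo_leq; [exact: lexx | by move=> ???; exact: le_trans |].
case=> [|n] /=; first by rewrite divr_ge0 // ltW ?reach_gt0.
rewrite ler_wpM2l // lef_pV2 ?posrE ?reach_gt0 // reachS.
by rewrite ler_piMr ?pass_le1 // ltW ?reach_gt0.
Qed.

(** If N + 1 has the level of N, no outcome exceeds that level.  Otherwise the
    carry, having erased all of N, either climbs one level with probability
    [pass] or falls to 0, and [ladder] is made for the two to compensate. *)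
Lemma expect_ladder c N : 0 <= c -> (0 < N)%N ->
  expect p N (fun M => ladder c (level M)) <= ladder c (level N).
Proof.
move=> c0 N0; rewrite -[leRHS](expect_cst p N).
have [ltN|geN] := ltnP N.+1 (fib (level N)).
  apply: ler_expect => M leM /=; apply: ladder_homo => //.
  by apply: level_le; apply: leq_ltn_trans leM ltN.
have EN : N.+1 = fib (level N).
  by apply/eqP; rewrite eqn_leq geN fib_level.
have [topE out0] := top_pos_full EN.
have lev1 : level N.+1 = (level N).+1 by rewrite EN level_fib.
rewrite !expectE !big_ord_recr lev1 /= out0 level0 /= mulr0 addr0.
case lE : (level N) => [|l] /=; first by move: EN; rewrite lE (_ : fib 0 = 1%N) //; lia.
rewrite survivalS.
have -> : p (height N).+1 = pass l.+1.
  congr p; congr S; move: topE; rewrite lE /top_pos.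
  have := fib_digits_le1 N 0; lia.
have -> : survival p (height N) * pass l.+1 * (c / reach l.+1) =
   survival p (height N) * (c / reach l).
  rewrite reachS; have r0 := lt0r_neq0 (reach_gt0 l).
  have p0 := lt0r_neq0 (pass_gt0 l.+1).
  by field; apply/andP.
rewrite -[leRHS]addrA; apply: lerD; last by rewrite -!mulrA -mulrDr -mulrDl subrK mul1r.
apply: ler_sum => j _; apply: ler_wpM2l.
  by rewrite mulr_ge0 ?subr_ge0 ?p_le1 // ltW ?survival_gt0.
rewrite -/(ladder c l.+1) -lE; apply: ladder_homo => //.
by apply/level_homo/outcome_le; apply: ltnW.
Qed.

End lyapunov.

Section potential.
Variables (R : realType) (p : nat -> R).
Hypothesis p01 : probability_sequence p.

Lemma scaled_time_le_fib n : scaled_time p n <= (fib n)%:R.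
Proof.
elim/ltn_ind: n => -[|[|n]] IH //.
rewrite scaled_timeSS fibSS natrD lerD ?IH //.
by apply: le_trans (IH n _) => //; rewrite ler_piMl ?pass_le1 // ltW ?scaled_time_gt0.
Qed.

Lemma scaled_time_homo : {homo scaled_time p : m n / (m <= n)%N >-> m <= n}.
Proof.
apply: homo_leq; [exact: lexx | by move=> ???; exact: le_trans |].
case=> [|n]; first by rewrite /= ler1n.
by rewrite scaled_timeSS lerDl mulr_ge0 // ltW ?pass_gt0 ?scaled_time_gt0.
Qed.

(** Positions 2m + 1 and 2m + 2 share the probability p_(m+2), and their
    increments add up to at most p_(m+2) (F_(2m) + F_(2m+1)) =
    p_(m+2) F_(2(m+1)). *)
Lemma scaled_time_le_sum m :
  scaled_time p m.*2.+1 <= 2 + \sum_(2 <= i < m.+2) p i * (fib (2 * (i - 1)))%:R.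
Proof.
elim: m => [|m IH]; first by rewrite big_geq // addr0.
rewrite doubleS scaled_timeSS scaled_timeSS big_nat_recr //=.
have -> : pass p m.*2.+1 = p m.+2 by rewrite /pass /= doubleK.
have -> : pass p m.*2.+2 = p m.+2 by rewrite /pass /= uphalf_double.
have -> : (2 * (m.+2 - 1) = m.*2.+2)%N by lia.
rewrite -[leLHS]addrA [leRHS]addrA lerD // -mulrDr fibSS natrD ler_wpM2l ?(ltW (p_gt0 _ _)) //.
by rewrite addrC; exact: lerD (scaled_time_le_fib m.*2.+1) (scaled_time_le_fib m.*2).
Qed.

Lemma scaled_time_bounded :
  (\sum_(2 <= i <oo) (p i * (fib (2 * (i - 1)))%:R)%:E < +oo)%E ->
  exists2 c, 0 <= c & forall n, scaled_time p n <= c.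
Proof.
move=> p_sum; set f := fun i => p i * (fib (2 * (i - 1)))%:R : R.
have f0 n : (2 <= n)%N -> true -> (0 <= (f n)%:E)%E.
  by case: n => // n _ _; rewrite lee_fin mulr_ge0 // ltW ?p_gt0.
have le_lim k := nneseries_lim_ge k f0.
set S := (\sum_(2 <= i <oo) _)%E in le_lim p_sum.
have S_ge0 : (0 <= S)%E by have := le_lim 0%N; rewrite big_geq.
have S_fin : S \is a fin_num by rewrite ge0_fin_numE.
exists (2 + fine S) => [|n]; first by rewrite addr_ge0 ?fine_ge0.
apply: le_trans (scaled_time_homo (_ : n <= n.*2.+1)%N) _.
  by rewrite -addnn; lia.
apply: le_trans (scaled_time_le_sum n) _; rewrite lerD2l -lee_fin fineK //.
by rewrite -sumEFin; exact: le_lim.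
Qed.

Lemma time_le_ladder c N : (forall n, scaled_time p n <= c) ->
  digit_weight (climb_time p) N <= ladder p c (level N).
Proof.
move=> lec; rewrite (digit_weightE _ (fib_digits_out (fib_level N))).
case: (level N) => [|n]; first by rewrite big_ord0.
apply: le_trans (sum_climb_time_leS p01 n (zeckendorf_digits N)) _.
rewrite pass_climb_time // ler_wpM2r ?lec // invr_ge0 ltW ?reach_gt0 //.
Qed.

(** Up to N0 the potential is K - u, which the clock makes decrease by one; the
    ladder is added above N0 only, where states differ from 0 and the ladder
    dominates u. *)
Lemma foster_potential c N0 : (forall n, scaled_time p n <= c) ->
  exists V : nat -> R, (forall N, 0 <= V N) /\
    (forall N, N <> N0 -> expect p N V <= V N - 1).
Proof.
move=> lec; have c0 : 0 <= c by apply: le_trans (lec 0%N).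
pose u := digit_weight (climb_time p).
have u0 N : 0 <= u N.
  by apply: sumr_ge0 => i _; rewrite mulrn_wge0 // ltW ?climb_time_gt0.
(* A crude bound for u on the states up to N0. *)
pose K := \sum_(i < N0.+1) u i.
pose L N := if (N0 < N)%N then ladder p c (level N) else 0.
have L0 N : 0 <= ladder p c (level N).
  exact: le_trans (u0 N) (time_le_ladder N lec).
exists (fun N => K + (- u N + L N)); split=> [N|N N_N0].
  rewrite /L; case: ltnP => [ltN|leN].
    rewrite addr_ge0 ?sumr_ge0 //.
    by rewrite addrC subr_ge0; exact: time_le_ladder.
  rewrite addr0 subr_ge0 /K (bigD1 (Ordinal (leN : N < N0.+1)%N)) //=.
  by rewrite lerDl sumr_ge0.
rewrite !expectD expectN expect_cst expect_time //.
suff : expect p N L <= L N by rewrite -/u; lra.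
have [ltN|leN] := ltnP N0 N.
  have N0' : (0 < N)%N by apply: leq_ltn_trans ltN.
  rewrite {2}/L ltN; apply: le_trans (expect_ladder p01 c0 N0').
  by apply: ler_expect => // M _; rewrite /L; case: ifP.
have {}leN : (N < N0)%N by lia.
rewrite {2}/L ltnNge ltnW //= -(expect_cst p N 0).
by apply: ler_expect => // M leM; rewrite /L ltnNge (leq_trans leM).
Qed.

End potential.

(** Witness: p_i = 1 / (2^i F_(2(i-1))). *)
Lemma summable_probability_sequence (R : realType) : exists p : nat -> R,
  probability_sequence p /\
  (\sum_(2 <= i <oo) (p i * (fib (2 * (i - 1)))%:R)%:E < +oo)%E.
Proof.
have fib0 n : 0 < (fib n)%:R :> R by rewrite ltr0n (leq_ltn_trans _ (fib_gt n)).
exists (fun i => (2 ^+ i * (fib (2 * (i - 1)))%:R)^-1); split.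
  move=> i _; rewrite invr_gt0 mulr_gt0 ?exprn_gt0 //=.
  rewrite invf_le1 ?mulr_gt0 ?exprn_gt0 //.
  rewrite mulr_ege1 ?exprn_ege1 ?ler1n //.
  exact: leq_ltn_trans (fib_gt _).
set f := fun i => _; rewrite (@eq_eseriesr _ _ (fun i => ((2 ^+ i)^-1)%:E)).
  apply: le_lt_trans (ltry 1); apply: lime_le.
    by apply: is_cvg_nneseries => n _ _; rewrite lee_fin invr_ge0 exprn_ge0.
  apply: nearW => n; rewrite sumEFin lee_fin.
  (* The sum is 1/2 - 2 / 2^n. *)
  suff : (2 <= n)%N -> \sum_(2 <= i < n) (2 ^+ i)^-1 <= 1 - 2 / 2 ^+ n :> R.
    have [len _|ltn /(_ isT)] := ltnP n 2; first by rewrite big_geq // ltnW.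
    have : 0 < (2 ^+ n)^-1 :> R by rewrite invr_gt0 exprn_gt0.
    lra.
  elim: n => // n IH; rewrite leq_eqVlt => /predU1P[<-|ltn].
    by rewrite big_geq // subr_ge0 expr2 invfM mulrA divff // mul1r invf_le1 // ler1n.
  rewrite big_nat_recr //=; have := IH ltn; rewrite exprS invfM mulrA divff //; lra.
move=> i _; rewrite /f; congr _%:E; rewrite invfM -mulrA mulVf ?mulr1 //.
exact: lt0r_neq0.
Qed.

Local Open Scope classical_set_scope.

(** * Law of the chain *)
Lemma measure_fibers (d : measure_display) (T : measurableType d) (R : realType)
    (mu : {measure set T -> \bar R}) (A : set T) (phi : T -> nat) n :
  (forall w, A w -> (phi w < n)%N) ->
  (forall i, (i < n)%N -> measurable (A `&` [set w | phi w = i])) ->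
  measurable A /\ (mu A = \sum_(i < n) mu (A `&` [set w | phi w = i]))%E.
Proof.
move=> ltn mA.
have AE : A = \big[setU/set0]_(i < n) (A `&` [set w | phi w = i]).
  apply/seteqP; split=> [w Aw|w]; rewrite -(bigcup_mkord n (fun i => A `&` [set w | phi w = i])).
    by exists (phi w); [exact: ltn | split].
  by case=> i _ [].
have mU : measurable A.
  by rewrite AE; apply: bigsetU_measurable => i _; exact: mA.
split=> //; rewrite {1}AE measure_semi_additive_ord -?AE // => [i|]; first exact: mA.
apply/trivIsetP => i j _ _ ij; apply/seteqP; split=> // w [[_ /= iE] [_ /= jE]].
by case/negP: ij; apply/eqP/val_inj; rewrite /= -iE -jE.
Qed.

Section draws.
Variables (d : measure_display) (T : measurableType d) (R : realType)
  (P : probability T R) (e : nat -> nat -> {RV P >-> bool}) (p : nat -> R).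
Hypothesis draws : fib_draws p e.

Definition cylinder (s : seq (nat * nat)) (b : nat * nat -> bool) : set T :=
  [set w | all (fun x => e x.1 x.2 w == b x) s].

(** The probability that draw number [x.2] of any row is [v]; the shift is that
    of the indexing of p from 1. *)
Definition bit_prob (x : nat * nat) (v : bool) : R :=
  if v then p x.2.+1 else 1 - p x.2.+1.

Lemma measurable_draw t i (B : set bool) : measurable (e t i @^-1` B).
Proof. by rewrite -[X in measurable X]setTI; exact: measurable_funP. Qed.

Lemma prob_draw t i v : P (e t i @^-1` [set v]) = (bit_prob (t, i) v)%:E.
Proof.
have [pe _] := draws; case: v => /=; first exact: pe.
rewrite /bit_prob /= EFinB -(pe t i) -probability_setC.
  congr (P _); apply/seteqP; split=> w /=; by case: (e t i w).
exact: (measurable_draw t i [set true]).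
Qed.

Lemma cylinderE s b : cylinder s b =
  \bigcap_(x in [set` s]) (e x.1 x.2 @^-1` [set b x]).
Proof.
by apply/seteqP; split=> w /=; [move=> /allP h x /h /eqP|move=> h; apply/allP => x /h /= ->].
Qed.

Lemma measurable_cylinder s b : measurable (cylinder s b).
Proof.
rewrite cylinderE; apply: fin_bigcap_measurable; first exact: finite_seq.
by move=> x _; exact: measurable_draw.
Qed.

Lemma prob_cylinder s b : uniq s ->
  P (cylinder s b) = (\prod_(x <- s) bit_prob x (b x))%:E.
Proof.
move=> us; have [_ indep] := draws.
have -> : cylinder s b = \bigcap_(x in [set` [fset x in s]%fset]) (e x.1 x.2 @^-1` [set b x]).
  rewrite cylinderE; congr bigcap.
  by apply/seteqP; split=> x /=; rewrite inE.
rewrite (indep [fset x in s]%fset (fun x => [set b x])) //.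
rewrite -prodEFin (perm_big s) /=; last first.
  by apply: uniq_perm => // [|x]; rewrite ?fset_uniq ?inE.
by apply: eq_bigr => -[t i] _; rewrite prob_draw.
Qed.

Lemma fib_chain_le N t w : (fib_chain e N t w <= N + t)%N.
Proof.
elim: t => [|t IH] /=; first by rewrite addn0.
by apply: leq_trans (fib_step_le _ _) _; rewrite addnS ltnS.
Qed.

Definition stage_row t N j : seq (nat * nat) :=
  [seq (t, i) | i <- iota 0 (minn j (height N)).+1].

Lemma prod_stage_row t N j (b : nat * nat -> bool) : (j <= (height N).+1)%N ->
  (forall i, b (t, i) = (i < j)%N) ->
  \prod_(x <- stage_row t N j) bit_prob x (b x) = outcome_prob p N j.
Proof.
move=> lej bt; rewrite big_map.
have prodE m : (m <= j)%N -> \prod_(i <- iota 0 m) bit_prob (t, i) (b (t, i)) =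
    survival p m.
  move=> lem; rewrite -[m]subn0 -/(index_iota 0 m) big_mkord subn0.
  by apply: eq_bigr => i _; rewrite bt /bit_prob (leq_trans (ltn_ord i) lem).
rewrite /outcome_prob; case: (leqP j (height N)) => [leh|lth].
  rewrite -addn1 iotaD big_cat big_seq1 prodE //; congr (_ * _).
  by rewrite add0n bt ltnn addn1.
have -> : j = (height N).+1 by apply/eqP; rewrite eqn_leq lej lth.
by rewrite prodE ?mulr1.
Qed.

Variable N0 : nat.

Definition avoid t : set T :=
  [set w | forall s, (0 < s <= t)%N -> fib_chain e N0 s w <> N0].

Lemma avoidS t w :
  avoid t.+1 w <-> avoid t w /\ fib_chain e N0 t.+1 w <> N0.
Proof.
split=> [h|[h ht] s /andP[s0]]; first split=> [s /andP[s0 st]|].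
- by apply: h; rewrite s0 ltnW.
- by apply: h; rewrite ltnSn.
by rewrite leq_eqVlt => /predU1P[->//|st]; apply: h; rewrite s0.
Qed.

(** The probability of being at [M] at time [t] without having come back to
    [N0] in between.  At time s the states do not exceed N0 + s, which makes the
    sum finite. *)
Fixpoint mass t M : R :=
  match t with
  | 0 => (M == N0)%:R
  | s.+1 => if M == N0 then 0 else
      \sum_(L < N0 + s.+1) mass s L * expect p L (fun K => (K == M)%:R)
  end.

(** Markov property.  The state at time t only depends on the rows before t, so
    it is independent of every cylinder on later rows.  The statement for all
    cylinders is what makes the induction work: given the state L at time t, the
    event that the step reaches stage j is itself a cylinder on row t, which is
    prepended to the given one. *)
Lemma prob_avoid_cylinder t M s b : uniq s -> all (fun x => t <= x.1)%N s ->
  let A := avoid t `&` [set w | fib_chain e N0 t w = M] `&` cylinder s b in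
  measurable A /\ P A = (mass t M * \prod_(x <- s) bit_prob x (b x))%:E.
Proof.
elim: t M s b => [|t IH] M s b us ts /=.
  have avoid0 : avoid 0 = setT.
    by apply/seteqP; split=> // w _ s' /andP[s0]; rewrite leqn0 (gtn_eqF s0).
  rewrite avoid0 setTI; case: eqVneq => [->|NM].
    rewrite mul1r -(prob_cylinder b us) (_ : [set w | N0 = N0] = setT) ?setTI.
      by split=> //; exact: measurable_cylinder.
    by apply/seteqP; split.
  rewrite (_ : [set w | N0 = M] = set0) ?set0I ?measure0 ?mul0r //.
  by apply/seteqP; split=> // w /= NM'; rewrite NM' eqxx in NM.
set A := _ `&` _ `&` _.
have [MN|NM] := eqVneq M N0.
  have -> : A = set0.
    by apply/seteqP; split=> // w [[/avoidS[_ ne] XM] _]; case: ne; exact: etrans XM MN.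
  by rewrite measure0 mul0r.
(* Row t prescribes stage j, the later rows are as before. *)
pose b' j (x : nat * nat) := if x.1 == t then (x.2 < j)%N else b x.
have piece L : (L < N0 + t.+1)%N ->
    let B := A `&` [set w | fib_chain e N0 t w = L] in measurable B /\
    P B = (mass t L * expect p L (fun K => (K == M)%:R) *
           \prod_(x <- s) bit_prob x (b x))%:E.
  move=> ltL B; pose phi w := stage L (fun i => e t i w).
  have fiber j : (j < (height L).+2)%N ->
      measurable (B `&` [set w | phi w = j]) /\
      P (B `&` [set w | phi w = j]) = (mass t L * (outcome_prob p L j *
        (outcome L j == M)%:R) * \prod_(x <- s) bit_prob x (b x))%:E.
    rewrite ltnS => lej; case: eqVneq => [oM|oM]; last first.
      have -> : B `&` [set w | phi w = j] = set0.
        apply/seteqP; split=> // w [[[[_ /= XM] _] /= XL] /= stj].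
        by move: XM; rewrite XL fib_stepE -/(phi w) stj => /eqP; rewrite (negbTE oM).
      by rewrite measure0 !mulr0 mul0r.
    have -> : B `&` [set w | phi w = j] = avoid t `&` [set w | fib_chain e N0 t w = L]
        `&` cylinder (stage_row t L j ++ s) (b' j).
      have cylE w : cylinder (stage_row t L j ++ s) (b' j) w <->
          phi w = j /\ cylinder s b w.
        rewrite /cylinder /mkset all_cat.
        have -> : all (fun x => e x.1 x.2 w == b' j x) (stage_row t L j) = (phi w == j).
          rewrite /phi stage_eqP // all_map; apply: eq_all => i.
          by rewrite /b' /= eqxx.
        rewrite (eq_in_all (a2 := fun x => e x.1 x.2 w == b x)).
          by split=> [/andP[/eqP-> ->]|[-> ->]]; rewrite ?eqxx.
        by move=> x /(allP ts) /= ltx; rewrite /b' gtn_eqF.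
      apply/seteqP; split=> w.
        move=> [[[[/avoidS[av _] _] cyl] XL] stj]; split=> //; exact/cylE.
      move=> [[av XL] /cylE[stj cyl]]; split=> //; split=> //; split=> //.
      have XM : fib_chain e N0 t.+1 w = M.
        by move: XL => /= ->; rewrite fib_stepE -/(phi w) stj.
      by split=> //; apply/avoidS; split=> //; rewrite XM; exact/eqP.
    have [] := IH L (stage_row t L j ++ s) (b' j).
    - rewrite cat_uniq us andbT map_inj_uniq ?iota_uniq => [|i i' []//] /=.
      apply/hasPn => x /(allP ts) /= ltx; apply/negP => /mapP[i _ xE].
      by move: ltx; rewrite xE /= ltnn.
    - rewrite all_cat; apply/andP; split; first by apply/allP => x /mapP[i _ ->] /=.
      by apply/allP => x /(allP ts) /ltnW.
    move=> mB ->; split=> //; rewrite big_cat /= prod_stage_row //; last first.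
      by move=> i; rewrite /b' eqxx.
    rewrite mulr1 mulrA; congr (_ * _)%:E; apply: eq_big_seq => x /(allP ts) /= ltx.
    by rewrite /b' gtn_eqF.
  have [|j ltj|mB ->] := @measure_fibers _ _ _ P B phi (height L).+2.
  - by move=> w _; rewrite ltnS stage_le.
  - by case: (fiber j ltj).
  split=> //; rewrite (eq_bigr _ (fun j _ => (fiber _ (ltn_ord j)).2)).
  by rewrite sumEFin /expect mulr_sumr mulr_suml.
have [w _|L ltL|mA ->] := @measure_fibers _ _ _ P A (fib_chain e N0 t) (N0 + t.+1)%N.
- by rewrite addnS ltnS fib_chain_le.
- by case: (piece L ltL).
split=> //; rewrite (eq_bigr _ (fun L _ => (piece _ (ltn_ord L)).2)).
by rewrite sumEFin mulr_suml.
Qed.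

End draws.

(** * Foster's argument *)
Section recurrence.
Variables (d : measure_display) (T : measurableType d) (R : realType)
  (P : probability T R) (e : nat -> nat -> {RV P >-> bool}) (p : nat -> R).
Hypothesis draws : fib_draws p e.
Hypothesis p01 : probability_sequence p.
Variable N0 : nat.

Lemma mass_ge0 t M : 0 <= mass p N0 t M.
Proof.
elim: t M => [|t IH] M /=; first by case: eqP.
case: ifP => // _; apply: sumr_ge0 => L _; rewrite mulr_ge0 //.
by rewrite -(expect_cst p L 0); apply: ler_expect.
Qed.

Lemma prob_avoid t : measurable (avoid e N0 t) /\
  P (avoid e N0 t) = (\sum_(M < N0 + t.+1) mass p N0 t M)%:E.
Proof.
have cylT b : cylinder e [::] b = setT by apply/seteqP; split.
have piece M := @prob_avoid_cylinder _ _ _ _ _ _ draws N0 t M [::] (fun=> true) isT isT.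
have [w _|M ltM|mA ->] := @measure_fibers _ _ _ P (avoid e N0 t) (fib_chain e N0 t) (N0 + t.+1)%N.
- by rewrite addnS ltnS fib_chain_le.
- by have [] := piece M; rewrite cylT setIT.
split=> //; rewrite -sumEFin; apply: eq_bigr => M _.
by have [_] := piece M; rewrite cylT setIT big_nil mulr1.
Qed.

(** The mean of V on the event that N0 has not been revisited loses the
    probability of this event at each step, and stays nonnegative. *)
Lemma sum_prob_avoid_le (V : nat -> R) n : (forall N, 0 <= V N) ->
  (forall N, N <> N0 -> expect p N V <= V N - 1) ->
  (\sum_(0 <= t < n) P (avoid e N0 t) <= (1 + expect p N0 V)%:E)%E.
Proof.
move=> V0 drift.
pose energy t := \sum_(M < N0 + t.+1) mass p N0 t M * V M.
have energyS t : energy t.+1 <= \sum_(L < N0 + t.+1) mass p N0 t L * expect p L V.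
  rewrite /energy /=.
  apply: le_trans (_ : \sum_(M < N0 + t.+2) \sum_(L < N0 + t.+1)
    mass p N0 t L * (expect p L (fun K => (K == M)%:R) * V M) <= _).
    apply: ler_sum => M _; case: ifP => _.
      rewrite mul0r; apply: sumr_ge0 => L _; rewrite mulr_ge0 ?mass_ge0 // mulr_ge0 //.
      by rewrite -(expect_cst p L 0); apply: ler_expect.
    by rewrite mulr_suml; apply: ler_sum => L _; rewrite mulrA.
  rewrite exchange_big /=; apply: ler_sum => L _.
  rewrite -mulr_sumr ler_wpM2l ?mass_ge0 //.
  under eq_bigr do rewrite mulr_suml.
  rewrite exchange_big /=; apply: ler_sum => j _.
  have out_lt : (outcome L j < N0 + t.+2)%N.
    rewrite (addnS N0 t.+1) ltnS; apply: leq_trans (ltn_ord L).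
    by apply: outcome_leS; rewrite -ltnS.
  rewrite (bigD1 (Ordinal out_lt)) //= eqxx mulr1 big1 ?addr0 // => M.
  by rewrite -val_eqE /= eq_sym => /negbTE ->; rewrite mulr0 mul0r.
have energy0 t : 0 <= energy t.
  by apply: sumr_ge0 => M _; rewrite mulr_ge0 ?mass_ge0.
have energy1 : energy 1 <= expect p N0 V.
  apply: le_trans (energyS 0%N) _ => /=.
  have ltN0 : (N0 < N0 + 1)%N by rewrite addn1.
  rewrite (bigD1 (Ordinal ltN0)) //= eqxx mul1r big1 ?addr0 // => M.
  by rewrite -val_eqE /= => /negbTE ->; rewrite mul0r.
(* The loss of one per step is not available at time 0, where the chain is at
   N0; hence the shift of the time index. *)
have energy_drop t : energy t.+2 + \sum_(M < N0 + t.+2) mass p N0 t.+1 M <= energy t.+1.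
  rewrite -lerBrDr; apply: le_trans (energyS _) _.
  rewrite -sumrB; apply: ler_sum => L _.
  have [LN|/eqP LN] := eqVneq (L : nat) N0; first by rewrite /= LN eqxx !mul0r subr0.
  by rewrite -[X in _ - X]mulr1 -mulrBr ler_wpM2l ?mass_ge0 ?drift.
have total m : \sum_(0 <= t < m) (\sum_(M < N0 + t.+2) mass p N0 t.+1 M) + energy m.+1
    <= expect p N0 V.
  elim: m => [|m IH]; first by rewrite big_geq // add0r.
  rewrite big_nat_recr //=; apply: le_trans IH; rewrite -addrA lerD2l.
  by rewrite addrC; exact: energy_drop.
case: n => [|n].
  rewrite big_geq // lee_fin addr_ge0 // -(expect_cst p N0 0).
  exact: ler_expect.
rewrite big_nat_recl // EFinD leeD //; first exact: probability_le1 (prob_avoid 0).1.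
under eq_bigr do rewrite (prob_avoid _).2.
by rewrite sumEFin lee_fin; apply: le_trans (total n); rewrite lerDl.
Qed.

Lemma return_time_infty w : ~ (exists n, (0 < n)%N /\ fib_chain e N0 n w = N0) ->
  return_time R (fib_chain e N0) N0 w = +oo%E.
Proof.
move=> never; rewrite /return_time (_ : [set _ | _ in _] = set0) ?ereal_inf0 //.
by apply/seteqP; split=> // _ [n /= [n0 Xn] _]; apply: never; exists n.
Qed.

(** The tail formula E[tau] = \sum_t P(tau > t), before taking means. *)
Lemma return_time_sum w : return_time R (fib_chain e N0) N0 w =
  (\sum_(0 <= t <oo) (\1_(avoid e N0 t) w)%:E)%E.
Proof.
have ind_ge0 t : (0 <= (\1_(avoid e N0 t) w)%:E :> \bar R)%E.
  by rewrite lee_fin indicE.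
have [[n [n_gt0 Xn]]|never] :=
    pselect (exists n, (0 < n)%N /\ fib_chain e N0 n w = N0); last first.
  have avoid_all t : avoid e N0 t w.
    by move=> s /andP[s0 _] Xs; apply: never; exists s.
  rewrite return_time_infty //; apply/esym/eqyP => A A0; have := archi_boundP (ltW A0).
  set n := Num.bound A => ltA.
  apply: le_trans (nneseries_lim_ge n (fun t _ _ => ind_ge0 t)).
  rewrite sumEFin lee_fin (eq_bigr (fun=> 1)) => [|t _]; last first.
    by rewrite indicE mem_set.
  by rewrite big_const_nat subn0 iter_addr_0; exact: ltW.
have ex : exists n, (0 < n)%N && (fib_chain e N0 n w == N0).
  by exists n; rewrite n_gt0; apply/eqP.
case: (ex_minnP ex) => {n n_gt0 Xn} m /andP[m_gt0 /eqP Xm] min_m.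
have avoidE t : \1_(avoid e N0 t) w = (t < m)%:R :> R.
  rewrite indicE; case: ltnP => [ltm|lem]; last first.
    by rewrite memNset // => /(_ m); rewrite m_gt0 => /(_ lem).
  rewrite mem_set // => s /andP[s0 les] Xs.
  by have := min_m s; rewrite s0 Xs eqxx => /(_ isT); rewrite leqNgt (leq_ltn_trans les).
transitivity (m%:R%:E : \bar R).
  apply/eqP; rewrite eq_le; apply/andP; split.
    by apply: ereal_inf_lbound; exists m.
  apply: le_ereal_inf_tmp => _ [n /= [n0 Xn] <-]; rewrite lee_fin ler_nat.
  by apply: min_m; rewrite n0; apply/eqP.
rewrite (nneseries_split 0 m) // add0n [X in (_ + X)%E]eseries0 => [|t lem _]; last first.
  by rewrite avoidE ltnNge lem.
rewrite adde0 sumEFin big_nat (eq_bigr (fun=> 1)) => [|t /andP[_ ltm]]; last first.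
  by rewrite avoidE ltm.
by rewrite -big_nat big_const_nat subn0 iter_addr_0.
Qed.

(** The means of the tail formula sum to a finite value, and Borel-Cantelli
    applied to the same series excludes that the chain never comes back. *)
Lemma positive_recurrent_at B : (forall n,
    (\sum_(0 <= t < n) P (avoid e N0 t) <= B%:E)%E) ->
  P [set w | (return_time R (fib_chain e N0) N0 w < +oo)%E] = 1%E /\
  (\int[P]_w return_time R (fib_chain e N0) N0 w < +oo)%E.
Proof.
move=> sum_le; have mavoid t := (prob_avoid t).1.
have sum_lty : (\sum_(0 <= t <oo) P (avoid e N0 t) < +oo)%E.
  apply: le_lt_trans (ltry B); apply: lime_le; last exact: nearW.
  by apply: is_cvg_nneseries => t _ _; exact: measure_ge0.
split; last first.
  rewrite (eq_integral _ _ (fun w _ => return_time_sum w)) integral_nneseries //.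
  - by under eq_eseriesr do rewrite integral_indic // setIT.
  - by move=> t; apply/measurable_EFinP; exact: measurable_indic.
(* The events [avoid] decrease, so that their limsup is their intersection. *)
have -> : [set w | (return_time R (fib_chain e N0) N0 w < +oo)%E] =
    ~` lim_sup_set (avoid e N0).
  apply/seteqP; split=> w /= => [lty /(_ _ I) limsup|nlim].
    have [[n [n_gt0 Xn]]|/return_time_infty E] :=
        pselect (exists n, (0 < n)%N /\ fib_chain e N0 n w = N0); last first.
      by rewrite E ltxx in lty.
    by have [j /= lenj /(_ n)] := limsup n; apply=> //; rewrite n_gt0.
  rewrite ltey; apply/eqP => E; apply: nlim => n _; exists n => //= s /andP[s0 _] Xs.
  suff : (return_time R (fib_chain e N0) N0 w <= s%:R%:E)%E by rewrite E leye_eq.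
  by apply: ereal_inf_lbound; exists s.
rewrite probability_setC ?lim_sup_set_cvg0 ?sube0 //.
by apply: bigcapT_measurable => n; apply: bigcup_measurable => j _.
Qed.

End recurrence.

Local Close Scope classical_set_scope.

Theorem theorem2p7 (R : realType) :
  (exists p : nat -> R,
     probability_sequence p /\ fib_machine_positive_recurrent p) /\
  (forall p : nat -> R, probability_sequence p ->
     (\sum_(2 <= i <oo) (p i * (fib (2 * (i - 1)))%:R)%:E < +oo)%E ->
     fib_machine_positive_recurrent p).
Proof.
have sufficient (p : nat -> R) : probability_sequence p ->
    (\sum_(2 <= i <oo) (p i * (fib (2 * (i - 1)))%:R)%:E < +oo)%E ->
    fib_machine_positive_recurrent p.
  move=> p01 p_sum d T P e draws N.
  have [c _ time_le] := scaled_time_bounded p01 p_sum.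
  have [V [V_ge0 drift]] := foster_potential p01 N time_le.
  apply: (positive_recurrent_at draws (B := 1 + expect p N V)) => n.
  exact: sum_prob_avoid_le draws p01 N V n V_ge0 drift.
split; last exact: sufficient.
have [p [p01 p_sum]] := summable_probability_sequence R.
by exists p; split=> //; exact: sufficient.
Qed.
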